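(* Let $K$ be an algebraically closed field and let $G$ be a finite, connected, undirected graph without loops or multiple edges. If $G$ is bipartite, then the toric ideal $I_G$ associated to $G$ satisfies ${\rm bar}(I_G)=\mu(I_G)$ and ${\rm ara}_G(I_G)=\mu(I_G)$.
   Context: Let $G$ have vertex set $V(G)=\{v_1,\ldots,v_n\}$ and edge set $E(G)=\{e_1,\ldots,e_m\}$. For $1\le i\le m$ let ${\bf a}_i=(a_{1,i},\ldots,a_{n,i})\in\mathbb{Z}^n$, where $a_{j,i}=1$ if $v_j$ is one of the two vertices of $e_i$ and $a_{j,i}=0$ otherwise. The toric ideal $I_G\subset K[x_1,\ldots,x_m]$ is the kernel of the $K$-algebra homomorphism $\phi:K[x_1,\ldots,x_m]\to K[t_1,\ldots,t_n]$ with $\phi(x_i)=t_1^{a_{1,i}}\cdots t_n^{a_{n,i}}$ (so $\phi(x_i)=t_kt_l$ if $e_i=\{v_k,v_l\}$). It is a prime ideal. The $G$-degree of a monomial ${\bf x}^{\bf u}=x_1^{u_1}\cdots x_m^{u_m}$ is $\deg_G({\bf x}^{\bf u})=u_1{\bf a}_1+\cdots+u_m{\bf a}_m$. A polynomial is $G$-homogeneous if all monomials in its nonzero terms have the same $G$-degree. A binomial is a difference of two monomials ${\bf x}^{\bf u}-{\bf x}^{\bf v}$. Let $rad(\cdot)$ denote the radical of the ideal generated by the listed polynomials. The binomial arithmetical rank ${\rm bar}(I_G)$ is the smallest integer $s$ for which there exist binomials $F_1,\ldots,F_s\in I_G$ with $I_G=rad(F_1,\ldots,F_s)$. The $G$-homogeneous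 arithmetical rank ${\rm ara}_G(I_G)$ is the smallest integer $s$ for which there exist $G$-homogeneous polynomials $F_1,\ldots,F_s\in I_G$ with $I_G=rad(F_1,\ldots,F_s)$. $\mu(I_G)$ denotes the minimal number of generators of $I_G$. *)

(* Defs.v *)
From HB Require Import structures.
From mathcomp Require Import all_boot all_order all_algebra.
From mathcomp Require Import mpoly.

Set Implicit Arguments.
Unset Strict Implicit.
Unset Printing Implicit Defensive.

Import GRing.Theory.
Local Open Scope ring_scope.

Section Ideals.
Variable R : comNzRingType.

Definition gen_ideal (s : nat) (F : 'I_s -> R) (p : R) : Prop :=
  exists c : 'I_s -> R, p = \sum_(i < s) c i * F i.

Definition radical (I : R -> Prop) (p : R) : Prop :=
  exists2 k : nat, (0 < k)%N & I (p ^+ k).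

Definition eq_ideal (I J : R -> Prop) : Prop := forall p : R, I p <-> J p.

End Ideals.

Definition is_least (P : nat -> Prop) (s : nat) : Prop :=
  P s /\ forall k : nat, P k -> (s <= k)%N.

(* A graph on the vertices 'I_n with edges labelled by 'I_m is given by the map
   sending an edge to the set of its endpoints: cardinality 2 excludes loops
   and injectivity excludes multiple edges. *)
Section Graphs.
Variables (n m : nat) (e : 'I_m -> {set 'I_n}).

Definition simple_graph : Prop :=
  injective e /\ forall i : 'I_m, #|e i| = 2%N.

Definition adj : rel 'I_n := fun u v => [exists i, e i == [set u; v]].

Definition connected_graph : Prop :=
  (0 < n)%N /\ forall u v : 'I_n, connect adj u v.

Definition bipartite_graph : Prop :=
  exists A : {set 'I_n}, forall u v : 'I_n, adj u v -> (u \in A) != (v \in A).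

Definition edge_vec (i : 'I_m) : 'X_{1..n} :=
  [multinom (j \in e i : nat) | j < n].

(* The G-degree lies in the submonoid nat^n of Z^n. *)
Definition gdeg (u : 'X_{1..m}) : 'X_{1..n} :=
  (\sum_(i < m) edge_vec i *+ u i)%MM.

End Graphs.

Section ToricIdeal.
Variables (K : closedFieldType) (n m : nat) (e : 'I_m -> {set 'I_n}).

Definition toric_map (p : {mpoly K[m]}) : {mpoly K[n]} :=
  p \mPo [tuple 'X_[edge_vec e i] | i < m].

Definition toric_ideal (p : {mpoly K[m]}) : Prop := toric_map p = 0.

Definition is_binomial (p : {mpoly K[m]}) : Prop :=
  exists u v : 'X_{1..m}, p = 'X_[u] - 'X_[v].

Definition G_homogeneous (p : {mpoly K[m]}) : Prop :=
  forall u v : 'X_{1..m},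
    u \in msupp p -> v \in msupp p -> gdeg e u = gdeg e v.

Definition is_mu (I : {mpoly K[m]} -> Prop) : nat -> Prop :=
  is_least (fun s => exists F : 'I_s -> {mpoly K[m]},
    eq_ideal I (gen_ideal F)).

Definition is_bar (I : {mpoly K[m]} -> Prop) : nat -> Prop :=
  is_least (fun s => exists F : 'I_s -> {mpoly K[m]},
    (forall i, I (F i) /\ is_binomial (F i)) /\
    eq_ideal I (radical (gen_ideal F))).

Definition is_ara_G (I : {mpoly K[m]} -> Prop) : nat -> Prop :=
  is_least (fun s => exists F : 'I_s -> {mpoly K[m]},
    (forall i, I (F i) /\ G_homogeneous (F i)) /\
    eq_ideal I (radical (gen_ideal F))).

End ToricIdeal.

Arguments toric_ideal K {n m} e p.

(* Main.v *)
(* The minimal vertex sets supporting two distinct monomials of equal G-degree are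
   the vertex sets S of the chordless cycles, and the fiber of the degree 1_S
   consists of the two alternating products of edges x^u and x^v of the cycle.

   Generation: let u and v have the same degree. If a chain in their fiber, in which
   neighbours share a variable, joins them, induct on the degree. Following edges of
   u out of one side of the bipartition and edges of v out of the other side, one
   meets an alternating cycle; replacing half of it in u yields such a chain, unless
   u and v are the two halves of the cycle. In that case a chord reroutes the cycle
   and again yields a chain, so that the cycle must be chordless.

   Lower bounds: the linear form f |-> f@_u is dual to the cycle binomials and kills
   (x_1, ..., x_m) I_G, so that I_G needs as many generators as there are chordless
   cycles. If G-homogeneous F_i generate I_G up to radical, then killing the edges
   not contained in S must leave some F_i nonzero; this F_i contains two monomials
   supported on S, so that by minimality S is the support of the degree of F_i.
   Hence different cycles require different F_i. *)
Require Import Defs.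
From mathcomp Require Import all_boot all_order all_algebra.
From mathcomp Require Import mpoly.

Set Implicit Arguments.
Unset Strict Implicit.
Unset Printing Implicit Defensive.

Import GRing.Theory.
Local Open Scope ring_scope.

(** * The [G]-degree as an additive map on exponents *)

Section GDegree.
Variables (n m : nat) (e : 'I_m -> {set 'I_n}).

Lemma gdegE u x : gdeg e u x = (\sum_(i | x \in e i) u i)%N.
Proof.
rewrite mnm_sumE [RHS]big_mkcond; apply: eq_bigr => i _.
by rewrite mulmnE mnmE; case: (x \in e i); rewrite ?mul1n.
Qed.

Lemma gdegD u v : gdeg e (u + v) = (gdeg e u + gdeg e v)%MM.
Proof.
by apply/mnmP => x; rewrite mnmDE !gdegE -big_split; apply: eq_bigr => i _;
  rewrite mnmDE.
Qed.

Lemma gdeg0 : gdeg e 0 = 0%MM.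
Proof.
by apply/mnmP => x; rewrite gdegE mnm0E big1 // => i _; rewrite mnm0E.
Qed.

Lemma gdegU i : gdeg e U_(i) = edge_vec e i.
Proof.
apply/mnmP => x; rewrite gdegE mnmE; case: (boolP (x \in e i)) => xi.
  rewrite (bigD1 i) //= mnm1E eqxx big1 // => j /andP[_ ji].
  by rewrite mnm1E eq_sym (negbTE ji).
apply: big1 => j xj; rewrite mnm1E; case: eqP => // ij.
by rewrite ij xj in xi.
Qed.

Lemma gdegB u v : (v <= u)%MM -> gdeg e (u - v) = (gdeg e u - gdeg e v)%MM.
Proof. by move=> vu; rewrite -{2}(submK vu) gdegD addmK. Qed.

Lemma leq_gdeg (u : 'X_{1..m}) i x : x \in e i -> (u i <= gdeg e u x)%N.
Proof. by move=> xi; rewrite gdegE (bigD1 i) //= leq_addr. Qed.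

Lemma gdeg_gt0P (u : 'X_{1..m}) x :
  reflect (exists2 i, x \in e i & (0 < u i)%N) (0 < gdeg e u x)%N.
Proof.
apply: (iffP idP) => [|[i xi ui]]; last exact: leq_trans ui (leq_gdeg u xi).
rewrite gdegE lt0n sum_nat_eq0 negb_forall => /existsP[i].
by rewrite negb_imply => /andP[xi ui]; exists i; rewrite ?lt0n.
Qed.

Lemma mnm_neq0P (k : nat) (u : 'X_{1..k}) :
  reflect (exists i, (0 < u i)%N) (u != 0%MM).
Proof.
apply: (iffP idP) => [u0|[i ui]]; last first.
  by apply/eqP => u0; rewrite u0 mnm0E in ui.
apply/existsP; rewrite -[X in is_true X]negbK negb_exists.
apply: contra u0 => /forallP u0.
by apply/eqP/mnmP => i; rewrite mnm0E; apply/eqP; rewrite -leqn0 leqNgt u0.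
Qed.

Hypothesis edge_card : forall i, #|e i| = 2%N.

Lemma gdeg_eq0 u : gdeg e u = 0%MM -> u = 0%MM.
Proof.
move=> du; apply/eqP; apply: contraTT isT => /mnm_neq0P[i ui].
have /card_gt0P[x xi] : (0 < #|e i|)%N by rewrite edge_card.
by have := leq_gdeg u xi; rewrite du mnm0E leqNgt ui.
Qed.

Lemma lem_gdeg_eq u v : (v <= u)%MM -> gdeg e u = gdeg e v -> u = v.
Proof.
move=> vu duv; rewrite -(submK vu) (_ : (u - v)%MM = 0%MM) ?add0m //.
apply: gdeg_eq0; rewrite gdegB // duv.
by apply/mnmP => x; rewrite mnmBE subnn mnm0E.
Qed.

End GDegree.

(** * Directed cycles and their alternating halves *)

Section Circuits.
Variables (n m : nat) (e : 'I_m -> {set 'I_n}).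

Definition mate (i : 'I_m) (x : 'I_n) := odflt x [pick y in e i :\ x].

Definition step (g : {ffun 'I_n -> 'I_m}) x := mate (g x) x.

(* [g x] is the edge along which one leaves [x]; minimality among the sets closed
   under [step] makes [S] a single directed cycle, possibly of length 2. *)
Definition circuit (g : {ffun 'I_n -> 'I_m}) (S : {set 'I_n}) :=
  [&& S != set0, step g @: S \subset S, [forall x in S, x \in e (g x)]
   & [forall X : {set 'I_n},
       [&& X \subset S, X != set0 & step g @: X \subset X] ==> (X == S)]].

(* With [B] one side of the bipartition: the product of every other edge. *)
Definition half_cycle (g : {ffun 'I_n -> 'I_m}) (S B : {set 'I_n}) : 'X_{1..m} :=
  (\sum_(x in S :&: B) U_(g x))%MM.

(* The last condition excludes going back and forth along one edge. *)
Definition chordless (g : {ffun 'I_n -> 'I_m}) (S : {set 'I_n}) :=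
  [&& circuit g S, [forall i, (e i \subset S) ==> (i \in g @: S)]
    & [forall x in S, g (step g x) != g x]].

Definition mnm_set (S : {set 'I_n}) : 'X_{1..n} :=
  [multinom (x \in S : nat) | x < n].

Hypothesis edge_card : forall i, #|e i| = 2%N.

Lemma mateP i x : x \in e i -> e i = [set x; mate i x] /\ mate i x != x.
Proof.
move=> xi; have := edge_card i; rewrite (cardsD1 x) xi => -[] /eqP/cards1P[y exy].
have my : mate i x = y.
  rewrite /mate; case: pickP => [z|/(_ y)]; first by rewrite exy => /set1P.
  by rewrite exy inE eqxx.
rewrite my; split; first by rewrite -(setD1K xi) exy.
have : y \in e i :\ x by rewrite exy inE.
by rewrite !inE => /andP[].
Qed.

Lemma mate_mem i x : x \in e i -> mate i x \in e i.
Proof. by move=> xi; rewrite (mateP xi).1 !inE eqxx orbT. Qed.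

Lemma edge_vec_mate i x : x \in e i -> edge_vec e i = (U_(x) + U_(mate i x))%MM.
Proof.
case/mateP=> eix mx; apply/mnmP => y; rewrite mnmE mnmDE !mnm1E eix !inE.
rewrite [x == y]eq_sym [_ == y]eq_sym.
by case: (y =P x) => [->|_] //=; rewrite eq_sym (negbTE mx).
Qed.

Section OneCircuit.
Variables (g : {ffun 'I_n -> 'I_m}) (S : {set 'I_n}).
Hypothesis circ : circuit g S.

Lemma circuit_neq0 : S != set0. Proof. by case/and4P: circ. Qed.

Lemma circuit_step x : x \in S -> step g x \in S.
Proof. by case/and4P: circ => _ /subsetP cl _ _ xS; apply/cl/imset_f. Qed.

Lemma circuit_mem x : x \in S -> x \in e (g x).
Proof. by case/and4P: circ => _ _ /'forall_implyP + _; apply. Qed.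

(** Serves as induction around the cycle: what holds at one vertex and passes along [step] holds on
    all of [S]. *)
Lemma circuit_min (X : {set 'I_n}) x : X \subset S -> x \in X ->
  {in X, forall y, step g y \in X} -> X = S.
Proof.
case/and4P: circ => _ _ _ /forallP/(_ X)/implyP H XS xX Xcl; apply/eqP/H.
rewrite XS /=; apply/andP; split; first by apply/set0Pn; exists x.
by apply/subsetP => _ /imsetP[y yX ->]; apply: Xcl.
Qed.

Lemma circuit_imset : step g @: S = S.
Proof.
have /set0Pn[x xS] := circuit_neq0.
have sub : step g @: S \subset S by case/and4P: circ.
apply: (@circuit_min _ (step g x)) => //; first exact: imset_f.
by move=> y /(subsetP sub) yS; apply: imset_f.
Qed.

Lemma circuit_inj : {in S &, injective (step g)}.
Proof. by apply/imset_injP; rewrite circuit_imset. Qed.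

Lemma circuit_edge x : x \in S -> e (g x) = [set x; step g x].
Proof. by move/circuit_mem/mateP => []. Qed.

Variable B : {set 'I_n}.
Hypothesis bip : forall i x, x \in e i -> (mate i x \in B) = (x \notin B).

Lemma circuit_side x : x \in S -> (step g x \in B) = (x \notin B).
Proof. by move/circuit_mem/bip. Qed.

(** Each [x] in [S :&: B] contributes itself and [step g x], and [step g] maps [S :&: B] bijectively
    onto [S :\: B]. *)
Lemma gdeg_half : gdeg e (half_cycle g S B) = mnm_set S.
Proof.
rewrite /half_cycle (big_morph _ (gdegD e) (gdeg0 e)).
under eq_bigr => x /setIP[xS _].
  rewrite gdegU (edge_vec_mate (circuit_mem xS)); over.
rewrite big_split /=.
have -> : (\sum_(x in S :&: B) U_(mate (g x) x) = \sum_(x in S :\: B) U_(x))%MM.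
  rewrite -(@big_imset _ _ _ _ _ (step g) (mem (S :&: B)) (fun x => U_(x)%MM)) /=;
    last first.
    by move=> x y /setIP[xS _] /setIP[yS _]; apply: circuit_inj.
  apply: eq_bigl => y; apply/imsetP/setDP => [[x /setIP[xS xB] ->]|[yS yB]].
    by rewrite circuit_step ?circuit_side // xB.
  have := yS; rewrite -{1}circuit_imset => /imsetP[x xS yx]; exists x => //.
  by rewrite inE xS -[x \in B]negbK -circuit_side // -yx yB.
rewrite -big_setID /=.
apply/mnmP => y; rewrite mnm_sumE mnmE; case: (boolP (y \in S)) => yS.
  rewrite (bigD1 y) //= mnm1E eqxx big1 // => x /andP[_ xy].
  by rewrite mnm1E (negbTE xy).
by apply: big1 => x xS; rewrite mnm1E; case: eqP => // xy; rewrite -xy xS in yS.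
Qed.

(** An edge has only one endpoint in [B], so the edges [g x] with [x] in [S :&: B] are distinct and
    the exponents of the half are at most 1. *)
Lemma half_le (u : 'X_{1..m}) :
  (forall x, x \in S :&: B -> (0 < u (g x))%N) -> (half_cycle g S B <= u)%MM.
Proof.
move=> gu; apply/mnm_lepP => i; rewrite mnm_sumE.
case: (pickP [pred x in S :&: B | g x == i]) => [x /andP[/= xSB /eqP gxi]|no].
  rewrite (bigD1 x) //= gxi mnm1E eqxx big1 ?addn0 -?gxi ?gu // => y /andP[ySB yx].
  rewrite mnm1E; case: eqP => // gy; case/eqP: yx.
  move: xSB ySB => /setIP[xS xB] /setIP[yS yB].
  have := circuit_mem yS; rewrite gy (circuit_edge xS) !inE => /orP[/eqP //|/eqP yx].
  by have := circuit_side xS; rewrite -yx yB xB.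
rewrite big1 // => x xSB; rewrite mnm1E.
by have := no x; rewrite inE xSB /= => ->.
Qed.

Lemma half_gt0 x : x \in S :&: B -> (0 < half_cycle g S B (g x))%N.
Proof. by move=> xSB; rewrite mnm_sumE (bigD1 x) //= mnm1E eqxx. Qed.

Lemma half_supp i : (0 < half_cycle g S B i)%N -> exists2 x, x \in S :&: B & i = g x.
Proof.
rewrite mnm_sumE lt0n sum_nat_eq0 negb_forall => /existsP[x].
by rewrite negb_imply mnm1E eqb0 negbK => /andP[xSB /eqP <-]; exists x.
Qed.

Lemma circuit_sideP : exists x, x \in S :&: B.
Proof.
have /set0Pn[x xS] := circuit_neq0; case: (boolP (x \in B)) => xB.
  by exists x; rewrite inE xS.
by exists (step g x); rewrite inE circuit_step // circuit_side.
Qed.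

Lemma half_neq0 : half_cycle g S B != 0%MM.
Proof. by have [x /half_gt0 ?] := circuit_sideP; apply/mnm_neq0P; exists (g x). Qed.

End OneCircuit.

End Circuits.

(** * Fibers of chordless cycles, and how these generate all fibers *)

Section Chordless.
Variables (n m : nat) (e : 'I_m -> {set 'I_n}) (A : {set 'I_n}).
Hypothesis edge_inj : injective e.
Hypothesis edge_card : forall i, #|e i| = 2%N.
Hypothesis bip : forall i x, x \in e i -> (mate e i x \in A) = (x \notin A).

Lemma bipC i x : x \in e i -> (mate e i x \in ~: A) = (x \notin ~: A).
Proof. by move=> xi; rewrite !in_setC bip. Qed.

Lemma gdeg_half2 g S : circuit e g S ->
  gdeg e (half_cycle g S A) = mnm_set S /\ gdeg e (half_cycle g S (~: A)) = mnm_set S.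
Proof.
by move=> circ; split; [exact: gdeg_half bip | exact: gdeg_half bipC].
Qed.

Section OneCycle.
Variables (g : {ffun 'I_n -> 'I_m}) (S : {set 'I_n}).
Hypothesis cg : chordless e g S.

Lemma chordless_circuit : circuit e g S. Proof. by case/and3P: cg. Qed.
Let circ := chordless_circuit.

Lemma chordless_edge i : e i \subset S -> i \in g @: S.
Proof. by case/and3P: cg => _ /'forall_implyP + _; apply. Qed.

Lemma chordless_step x : x \in S -> g (step e g x) != g x.
Proof. by case/and3P: cg => _ _ /'forall_implyP; apply. Qed.

Lemma chordless_inj : {in S &, injective g}.
Proof.
move=> x y xS yS gxy; have := circuit_mem circ yS.
rewrite -gxy (circuit_edge edge_card circ xS) !inE => /orP[/eqP //|/eqP yx].
by have := chordless_step xS; rewrite -yx gxy eqxx.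
Qed.

Lemma half_chordless B x : x \in S -> half_cycle g S B (g x) = (x \in B).
Proof.
move=> xS; rewrite mnm_sumE; case: (boolP (x \in B)) => xB.
  rewrite (bigD1 x) ?inE ?xS //= mnm1E eqxx big1 // => y /andP[/setIP[yS _] yx].
  by rewrite mnm1E; case: eqP => // /chordless_inj gyx; rewrite gyx ?eqxx in yx.
rewrite big1 // => y /setIP[yS yB]; rewrite mnm1E; case: eqP => // /chordless_inj yx.
by rewrite -yx ?yB in xB.
Qed.

Lemma half_disjoint i : (0 < half_cycle g S A i)%N -> half_cycle g S (~: A) i = 0%N.
Proof.
case/half_supp=> x /setIP[xS xA] ->.
by rewrite half_chordless // inE xA.
Qed.

Lemma half_neq : half_cycle g S A != half_cycle g S (~: A).
Proof.
have [x xSA] := circuit_sideP circ bip; have /setIP[xS xA] := xSA.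
by apply/eqP => /mnmP/(_ (g x)); rewrite !half_chordless // inE xA.
Qed.

Section Supported.
Variable p : 'X_{1..m}.
Hypothesis pS : forall y, y \notin S -> gdeg e p y = 0%N.

Lemma chordless_supp i : (0 < p i)%N -> i \in g @: S.
Proof.
move=> pi; apply: chordless_edge; apply/subsetP => z zi.
by apply: contraTT pi => /pS dz; rewrite -leqNgt -dz leq_gdeg.
Qed.

(** A variable of [p] is an edge inside [S], hence an edge of the cycle, and only two of these meet
    [step e g y]. *)
Lemma gdeg_chordless y : y \in S ->
  gdeg e p (step e g y) = (p (g y) + p (g (step e g y)))%N.
Proof.
move=> yS; have syS := circuit_step circ yS.
rewrite gdegE (bigD1 (g y)) /=; last first.
  by rewrite (circuit_edge edge_card circ yS) !inE eqxx orbT.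
rewrite (bigD1 (g (step e g y))) /=; last first.
  by rewrite (circuit_mem circ syS) chordless_step.
rewrite big1 ?addn0 // => i /andP[/andP[si iy] isy].
apply/eqP; rewrite -leqn0 leqNgt; apply/negP => /chordless_supp/imsetP[z zS iz].
move: si; rewrite iz (circuit_edge edge_card circ zS) !inE => /orP[/eqP yz|/eqP yz].
  by rewrite iz yz eqxx in isy.
by rewrite iz (circuit_inj circ yS zS yz) eqxx in iy.
Qed.

End Supported.

(* The values of [p] on consecutive edges of the cycle add up to the prescribed
   degree of their common vertex, hence each of them determines all the others. *)
Lemma chordless_eq (p q : 'X_{1..m}) x :
  (forall y, y \notin S -> gdeg e p y = 0%N) -> gdeg e p = gdeg e q ->
  x \in S -> p (g x) = q (g x) -> p = q.
Proof.
move=> pS dpq xS pqx.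
have qS y : y \notin S -> gdeg e q y = 0%N by rewrite -dpq; apply: pS.
have defS : [set y in S | p (g y) == q (g y)] = S.
  apply: (circuit_min circ (x := x)); first by apply/subsetP => y; rewrite inE => /andP[].
    by rewrite inE xS pqx eqxx.
  move=> y; rewrite !inE => /andP[yS /eqP pqy]; rewrite circuit_step //=.
  have := gdeg_chordless pS yS; rewrite dpq (gdeg_chordless qS yS) pqy.
  by move/addnI => ->.
apply/mnmP => i; case: (boolP (i \in g @: S)) => [/imsetP[y yS ->]|iS].
  by move: yS; rewrite -{1}defS inE => /andP[_ /eqP].
have z (r : 'X_{1..m}) : (forall y, y \notin S -> gdeg e r y = 0%N) -> r i = 0%N.
  move=> rS; apply/eqP; rewrite -leqn0 leqNgt.
  by apply: contra iS; apply: chordless_supp.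
by rewrite !z.
Qed.

Lemma mnm_set_out y : y \notin S -> mnm_set S y = 0%N.
Proof. by rewrite mnmE => /negbTE ->. Qed.

Lemma chordless_fiber w : gdeg e w = mnm_set S ->
  w = half_cycle g S A \/ w = half_cycle g S (~: A).
Proof.
move=> dw; have [du dv] := gdeg_half2 circ.
have wS y : y \notin S -> gdeg e w y = 0%N by rewrite dw; apply: mnm_set_out.
have /set0Pn[x xS] := circuit_neq0 circ.
have := gdeg_chordless wS xS; rewrite dw mnmE (circuit_step circ xS) => w1.
(* Degree 1 at the successor of [x] is split between two edges, so [w (g x)] is 0 or 1; each half
   takes one of these values. *)
have [wx|wx] : w (g x) = (x \in A) :> nat \/ w (g x) = (x \notin A) :> nat.
- case: (x \in A) (w (g x)) w1 => -[|[|k]] //=; by [left | right].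
- by left; apply: (chordless_eq wS _ xS); rewrite ?half_chordless ?dw.
- by right; apply: (chordless_eq wS _ xS); rewrite ?half_chordless ?dw ?inE.
Qed.

(** If the degree vanished at [y] in [S], both [p] and [q] would vanish on [g y] and agree by
    [chordless_eq]. *)
Lemma chordless_full (p q : 'X_{1..m}) :
  (forall y, y \notin S -> gdeg e p y = 0%N) -> gdeg e p = gdeg e q ->
  p <> q -> forall y, (gdeg e p y != 0)%N = (y \in S).
Proof.
move=> pS dpq pq y; case: (boolP (y \in S)) => yS; last by rewrite pS.
apply/eqP => dy; apply: pq; apply: (chordless_eq pS dpq yS).
have yi := circuit_mem circ yS.
have := leq_gdeg p yi; have := leq_gdeg q yi; rewrite -dpq dy.
by rewrite !leqn0 => /eqP -> /eqP ->.
Qed.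

End OneCycle.

Lemma circuit_exists (g : {ffun 'I_n -> 'I_m}) (X : {set 'I_n}) :
  X != set0 -> step e g @: X \subset X -> (forall x, x \in X -> x \in e (g x)) ->
  exists2 S : {set 'I_n}, S \subset X & circuit e g S.
Proof.
move=> X0 Xcl Xg.
have [S /minsetP[/andP[S0 Scl] minS] SX] :
    {S : {set 'I_n} | minset (fun Y => (Y != set0) && (step e g @: Y \subset Y)) S
       & S \subset X}.
  by apply: minset_exists; rewrite X0.
exists S => //; apply/and4P; split => //.
  by apply/'forall_implyP => x /(subsetP SX); apply: Xg.
apply/forallP => Y; apply/implyP => /and3P[YS Y0 Ycl].
by apply/eqP/minS => //; apply/andP.
Qed.

(** Leaving [A] along edges of [u] and its complement along edges of [v], one stays in the support
    of the common degree; a minimal closed subset of it is the cycle. *)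
Lemma circuit_in (u v : 'X_{1..m}) : u != 0%MM -> gdeg e u = gdeg e v ->
  exists g S, [/\ circuit e g S, (half_cycle g S A <= u)%MM
                 & (half_cycle g S (~: A) <= v)%MM].
Proof.
move=> /mnm_neq0P[i0 ui0] duv.
pose w x : 'X_{1..m} := if x \in A then u else v.
(* The default [i0] is taken only outside [X]. *)
pose g := [ffun x => odflt i0 [pick i | (x \in e i) && (0 < w x i)%N]].
pose X := [set x | (0 < gdeg e u x)%N].
have gP x : x \in X -> (x \in e (g x)) && (0 < w x (g x))%N.
  rewrite inE => dx; rewrite ffunE; case: pickP => //= no.
  have : (0 < gdeg e (w x) x)%N by rewrite /w; case: ifP; rewrite -?duv.
  by case/gdeg_gt0P=> i xi wi; have := no i; rewrite /= xi wi.
have dw x y : gdeg e (w x) y = gdeg e u y by rewrite /w; case: ifP; rewrite ?duv.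
have [x0 x0i] : exists x, x \in e i0.
  by apply/set0Pn; rewrite -cards_eq0 edge_card.
have [||x /gP/andP[]//|S SX circ] := @circuit_exists g X.
- by apply/set0Pn; exists x0; rewrite inE; apply/gdeg_gt0P; exists i0.
- apply/subsetP => _ /imsetP[x /gP/andP[xg wg] ->].
  by rewrite inE -(dw x); apply/gdeg_gt0P; exists (g x); rewrite // mate_mem.
exists g, S; split => //.
  by apply: (half_le edge_card circ bip) => x /setIP[/(subsetP SX)/gP/andP[_ +] xA];
    rewrite /w xA.
apply: (half_le edge_card circ bipC) => x /setIP[/(subsetP SX)/gP/andP[_ wx]].
by rewrite inE => xA; move: wx; rewrite /w (negbTE xA).
Qed.

(* Rerouting the cycle along the chord [i] at its endpoint in [A] gives a shorter
   cycle, and exchanging its two halves in [half_cycle g S (~: A)] gives the link. *)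
Lemma chord_link g S i : circuit e g S -> e i \subset S -> i \notin g @: S ->
  exists w : 'X_{1..m}, [/\ gdeg e w = mnm_set S,
    exists j, (0 < w j)%N && (0 < half_cycle g S A j)%N &
    exists j, (0 < w j)%N && (0 < half_cycle g S (~: A) j)%N].
Proof.
move=> circ iS ig.
have [a ai aA] : exists2 a, a \in e i & a \in A.
  have /set0Pn[x xi] : e i != set0 by rewrite -cards_eq0 edge_card.
  case: (boolP (x \in A)) => xA; first by exists x.
  by exists (mate e i x); rewrite ?mate_mem ?bip.
pose b := mate e i a; have bi : b \in e i by rewrite mate_mem.
have [eiab _] := mateP edge_card ai.
have bA : b \notin A by rewrite bip // aA.
have [aS bS] : a \in S /\ b \in S by split; apply: (subsetP iS).
have not_chord x y : x \in S -> y = step e g x -> e i != [set x; y].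
  move=> xS -> ; apply: contraNneq ig; rewrite -(circuit_edge edge_card circ xS).
  by move/edge_inj=> ->; apply: imset_f.
pose g' := [ffun x => if x == a then i else g x].
have step'a : step e g' a = b by rewrite /step ffunE eqxx.
have step' x : x != a -> step e g' x = step e g x.
  by rewrite /step ffunE => /negbTE ->.
have [||x xS|S' S'S circ'] := @circuit_exists g' S.
- exact: circuit_neq0 circ.
- apply/subsetP => _ /imsetP[x xS ->]; have [->|xa] := eqVneq x a.
    by rewrite step'a.
  by rewrite step' // circuit_step.
- by rewrite ffunE; case: eqP => [->|_] //; apply: circuit_mem circ _ xS.
(* Without [a], the set [S'] would be closed under the original [step e g], hence equal to [S]. *)
have aS' : a \in S'.
  apply: contraT => aS'; have /set0Pn[x xS'] := circuit_neq0 circ'.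
  suff S'E : S' = S by rewrite S'E aS in aS'.
  apply: (circuit_min circ S'S xS') => y yS'; rewrite -step' ?circuit_step //.
  by apply: contraNneq aS' => <-.
have bS' : b \in S' by rewrite -step'a circuit_step.
(* Otherwise [b] would have two predecessors under [step e g']: [a] and its old one. *)
have S'_neq : S' != S.
  apply/eqP => S'E; have := bS; rewrite -{1}(circuit_imset circ) => /imsetP[y yS by_].
  have [ya|ya] := eqVneq y a.
    have ab : b = step e g a by rewrite by_ ya.
    by case/eqP: (not_chord a b aS ab).
  by case/eqP: (ya); apply: (circuit_inj circ'); rewrite ?S'E // step'a step' // -by_.
have ba : b != a by apply: contraNneq bA => ->.
pose v := half_cycle g S (~: A).
pose u' := half_cycle g' S' A; pose v' := half_cycle g' S' (~: A).
have [du' dv'] := gdeg_half2 circ'; have [du dv] := gdeg_half2 circ.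
(* [g'] differs from [g] only at [a], which lies in [A]. *)
have v'v : (v' <= v)%MM.
  apply: (half_le edge_card circ' bipC) => x /setIP[xS' xA].
  rewrite ffunE; case: eqP => [xa|_]; first by rewrite xa inE aA in xA.
  by apply: half_gt0; rewrite inE (subsetP S'S).
exists (u' + (v - v'))%MM; split.
- by rewrite gdegD du' -dv' -gdegD addmC submK.
(* The edge leaving the successor [x] of [b] is shared with the first half; [x] is not [a], or the
   chord would join consecutive vertices. *)
- pose x := step e g b; have xE : step e g' b = x by rewrite step'.
  have xS' : x \in S' by rewrite -xE circuit_step.
  have xA : x \in A by rewrite (circuit_side circ bip bS).
  have xa : x != a.
    apply: contraTneq (not_chord b x bS erefl) => ->.
    by rewrite eiab setUC eqxx.
  have gx : g' x = g x by rewrite ffunE (negbTE xa).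
  exists (g x); rewrite half_gt0 ?inE ?(subsetP S'S x) ?xA // andbT mnmDE.
  by rewrite -gx ltn_addr // half_gt0 // inE xS'.
- have vv' : (v - v')%MM != 0%MM.
    apply: contra S'_neq => /eqP vv'; have : v' = v by rewrite -(submK v'v) vv' add0m.
    move/(congr1 (gdeg e)); rewrite dv dv' => /mnmP E; apply/eqP/setP => x.
    by have := E x; rewrite !mnmE; do 2 case: (x \in _).
  have [j j0] := mnm_neq0P _ vv'; exists j; rewrite mnmDE ltn_addl //=.
  by apply: leq_trans j0 _; rewrite mnmBE leq_subr.
Qed.

(** To be used with [P u v] saying that ['X_[u] - 'X_[v]] lies in the ideal of the cycle binomials.
    The last hypothesis covers both orientations of a cycle, and reversal swaps the halves. *)
Lemma fiber_ind (P : 'X_{1..m} -> 'X_{1..m} -> Prop) :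
  (forall u, P u u) -> (forall u v w, P u v -> P v w -> P u w) ->
  (forall w u v, P u v -> P (w + u)%MM (w + v)%MM) ->
  (forall g S, chordless e g S -> P (half_cycle g S A) (half_cycle g S (~: A))) ->
  forall u v, gdeg e u = gdeg e v -> P u v.
Proof.
move=> Prefl Ptrans Padd Pcirc u; have [k] := ubnP (mdeg (gdeg e u)).
elim: k u => // k IH u; rewrite ltnS => du v duv.
(* Cancelling the common variable lowers the degree. *)
have share u1 v1 : gdeg e u1 = gdeg e u -> gdeg e u1 = gdeg e v1 ->
    (exists j, (0 < u1 j)%N && (0 < v1 j)%N) -> P u1 v1.
  move=> du1 duv1 [j /andP[uj vj]].
  have le1 (w : 'X_{1..m}) : (0 < w j)%N -> (U_(j) <= w)%MM.
    by move=> wj; apply/mnm_lepP => l; rewrite mnm1E; case: eqP => // <-.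
  rewrite -(submK (le1 _ uj)) -(submK (le1 _ vj)) ![(_ + U_(j))%MM]addmC.
  apply/Padd/IH; last by rewrite !gdegB ?le1 // duv1.
  apply: leq_trans du; rewrite -du1 -{2}(submK (le1 _ uj)) gdegD mdegD.
  rewrite -[X in (X < _)%N]addn0 ltn_add2l lt0n mdeg_eq0.
  by apply/eqP => /(gdeg_eq0 edge_card)/eqP; rewrite mnm1_eq0.
have link w : gdeg e w = gdeg e u -> (exists j, (0 < w j)%N && (0 < u j)%N) ->
    (exists j, (0 < w j)%N && (0 < v j)%N) -> P u v.
  move=> dw [j wu] wv; apply: (Ptrans _ w); last by apply: share; rewrite // dw.
  by apply: share => //; exists j; rewrite andbC.
have [u0|u0] := eqVneq u 0%MM.
  suff -> : v = u by [].
  by rewrite u0; apply: (gdeg_eq0 edge_card); rewrite -duv u0 gdeg0.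
have [g [S [circ leu lev]]] := circuit_in u0 duv.
have [dh dh'] := gdeg_half2 circ.
have v0 := half_neq0 circ bipC.
have [uE|uN] := eqVneq u (half_cycle g S A); last first.
  (* This [w] shares the nonzero rest of [u] with [u] and the new half with [v]. *)
  pose w := (u - half_cycle g S A + half_cycle g S (~: A))%MM.
  have {}uN : (u - half_cycle g S A)%MM != 0%MM.
    by apply: contra uN => /eqP E; rewrite -(submK leu) E add0m.
  apply: (link w).
  - by rewrite gdegD dh' -dh -gdegD submK.
  - have [j j0] := mnm_neq0P _ uN; exists j; rewrite mnmDE ltn_addr //=.
    by apply: leq_trans j0 _; rewrite mnmBE leq_subr.
  - have [j j0] := mnm_neq0P _ v0; exists j; rewrite mnmDE ltn_addl //=.
    exact: leq_trans j0 (mnm_lepP lev j).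
have dhv : gdeg e v = gdeg e (half_cycle g S (~: A)) by rewrite -duv uE dh dh'.
have vE := lem_gdeg_eq edge_card lev dhv.
have [|] := boolP [exists j, (0 < u j)%N && (0 < v j)%N].
  by move=> /existsP uv; apply: share.
rewrite negb_exists => /forallP disj.
case: (boolP [forall i, (e i \subset S) ==> (i \in g @: S)]) => [noch|].
  rewrite uE vE; apply: Pcirc; apply/and3P; split=> //.
  (* An edge traversed back and forth would lie in both halves, which are disjoint here. *)
  apply/'forall_implyP => x xS; apply/eqP => gxs.
  have sx := circuit_side circ bip xS; have sxS := circuit_step circ xS.
  have hx (B : {set 'I_n}) y : y \in S -> y \in B -> (0 < half_cycle g S B (g y))%N.
    by move=> yS yB; apply: half_gt0; rewrite inE yS.
  have := disj (g x); rewrite uE vE; case: (boolP (x \in A)) sx => xA sx.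
    by rewrite hx //= -gxs hx // inE sx.
  by rewrite -{1}gxs hx //= hx // inE.
rewrite negb_forall => /existsP[i]; rewrite negb_imply => /andP[iS ig].
have [w [dw wu wv]] := chord_link circ iS ig.
by apply: (link w); rewrite ?uE ?vE // dw dh.
Qed.

End Chordless.

(** * Finitely generated ideals *)

Section GenIdeal.
Variables (R : comNzRingType) (s : nat) (F : 'I_s -> R).

Lemma gen_ideal0 : gen_ideal F 0.
Proof. by exists (fun=> 0); rewrite big1 // => i _; rewrite mul0r. Qed.

Lemma gen_idealD p q : gen_ideal F p -> gen_ideal F q -> gen_ideal F (p + q).
Proof.
move=> [c ->] [d ->]; exists (fun i => c i + d i).
by rewrite -big_split; apply: eq_bigr => i _; rewrite mulrDl.
Qed.

Lemma gen_idealM a p : gen_ideal F p -> gen_ideal F (a * p).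
Proof.
move=> [c ->]; exists (fun i => a * c i).
by rewrite mulr_sumr; apply: eq_bigr => i _; rewrite mulrA.
Qed.

Lemma gen_idealN p : gen_ideal F p -> gen_ideal F (- p).
Proof. by rewrite -mulN1r; apply: gen_idealM. Qed.

Lemma gen_ideal_mem i : gen_ideal F (F i).
Proof.
exists (fun j => (j == i)%:R); rewrite (bigD1 i) //= eqxx mul1r big1 ?addr0 //.
by move=> j /negbTE ->; rewrite mul0r.
Qed.

End GenIdeal.

(** * Membership in the toric ideal, and restriction to induced subgraphs *)

Section Toric.
Variables (K : closedFieldType) (n m : nat) (e : 'I_m -> {set 'I_n}).
Local Notation I := (toric_ideal K e).
Implicit Types f p : {mpoly K[m]}.

Lemma toric_mapX w : toric_map e 'X_[K, w] = 'X_[gdeg e w].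
Proof.
rewrite /toric_map comp_mpolyX (big_morph (@mpolyX n K) (@mpolyXD n K) (mpolyX0 n K)).
by apply: eq_bigr => i _; rewrite tnth_mktuple mpolyXn.
Qed.

Lemma toric_ideal_binomial u v : I ('X_[u] - 'X_[v]) <-> gdeg e u = gdeg e v.
Proof.
rewrite /toric_ideal /toric_map comp_mpolyB -!/(toric_map _ _) !toric_mapX.
split=> [/eqP|->]; last by rewrite subrr.
rewrite subr_eq0 => /eqP /(congr1 (mcoeff (gdeg e u))).
rewrite !mcoeffX eqxx; case: eqP => // _ /eqP.
by rewrite oner_eq0.
Qed.

Lemma toric_ideal_sum s (c F : 'I_s -> {mpoly K[m]}) :
  (forall i, I (F i)) -> I (\sum_i c i * F i).
Proof.
move=> IF; rewrite /toric_ideal /toric_map raddf_sum big1 // => i _ /=.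
by rewrite rmorphM /= -!/(toric_map _ _) (IF i) mulr0.
Qed.

Lemma toric_ideal_pow p k : I (p ^+ k) -> I p.
Proof.
rewrite /toric_ideal /toric_map rmorphXn /= => /eqP.
by rewrite expf_eq0 => /andP[_ /eqP].
Qed.

Lemma toric_coef f d : (toric_map e f)@_d = \sum_(w <- msupp f | gdeg e w == d) f@_w.
Proof.
rewrite /toric_map comp_mpolyEX raddf_sum [RHS]big_mkcond /=; apply: eq_bigr => w _.
rewrite mcoeffZ -/(toric_map _ _) toric_mapX mcoeffX.
by case: ifP; rewrite ?mulr1 ?mulr0.
Qed.

(** The coefficients of [f] over each fiber sum to zero, so no fiber meets the support in a single
    monomial. *)
Lemma toric_other f w : I f -> w \in msupp f ->
  exists w', [/\ w' \in msupp f, w' != w & gdeg e w' = gdeg e w].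
Proof.
move=> If wf; pose other w' := (w' != w) && (gdeg e w' == gdeg e w).
case: (boolP (has other (msupp f))).
  by case/hasP=> w' w'f /andP[w'w /eqP dw']; exists w'.
move=> /hasPn no; have := toric_coef f (gdeg e w); rewrite If mcoeff0.
rewrite big_mkcond (bigD1_seq w) //= eqxx big_seq_cond big1 ?addr0 => [/esym/eqP|w'].
  by rewrite mcoeff_eq0 wf.
by case/andP=> /no + w'w; rewrite /other w'w /= => /negbTE ->.
Qed.

(** Replacing each monomial of [f] by a representative [h] of its fiber gives zero, so [f] is a
    combination of differences of monomials of equal degree. *)
Lemma toric_generated (J : {mpoly K[m]} -> Prop) :
  J 0 -> (forall p q, J p -> J q -> J (p + q)) -> (forall a p, J p -> J (a * p)) ->
  (forall u v, gdeg e u = gdeg e v -> J ('X_[u] - 'X_[v])) ->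
  forall f, I f -> J f.
Proof.
move=> J0 JD JM Jb f If.
pose h d := nth 0%MM (msupp f) (find (fun w => gdeg e w == d) (msupp f)).
have hE w : w \in msupp f -> gdeg e (h (gdeg e w)) = gdeg e w.
  move=> wf; apply/eqP; rewrite /h.
  by apply: (@nth_find _ 0%MM (fun w' => gdeg e w' == gdeg e w)); apply/hasP; exists w.
have h0 : \sum_(w <- msupp f) f@_w *: 'X_[h (gdeg e w)] = 0.
  apply/mpolyP => k; rewrite raddf_sum mcoeff0 /=.
  (* If the fiber of [k] misses the support, the sum on the right is empty, whatever the default in
     [h]. *)
  have -> : \sum_(w <- msupp f) (f@_w *: 'X_[h (gdeg e w)])@_k =
      (h (gdeg e k) == k)%:R * \sum_(w <- msupp f | gdeg e w == gdeg e k) f@_w.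
    rewrite mulr_sumr [RHS]big_mkcond big_seq [RHS]big_seq; apply: eq_bigr => w wf.
    rewrite mcoeffZ mcoeffX; have := hE w wf; case: eqP => [hk|hk] dk.
      by rewrite hk in dk; rewrite dk eqxx hk eqxx mul1r mulr1.
    rewrite mulr0; case: (gdeg e w =P gdeg e k) => // dwk.
    by rewrite -dwk (introF eqP hk) mul0r.
  by rewrite -toric_coef If mcoeff0 mulr0.
rewrite (mpolyE f) -[X in J X]subr0 -[X in J (_ - X)]h0 -sumrB big_seq.
elim/big_ind: _ => // w wf; rewrite -scalerBr -mul_mpolyC.
by apply/JM/Jb; rewrite hE.
Qed.

(** Passage to the subgraph induced on [T]. *)
Definition restrict (T : {set 'I_n}) : {mpoly K[m]} -> {mpoly K[m]} :=
  comp_mpoly [tuple if e i \subset T then 'X_i else 0 | i < m].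

Lemma restrict_in (T : {set 'I_n}) (w : 'X_{1..m}) :
  (forall i, (0 < w i)%N -> e i \subset T) ->
  restrict T 'X_[w] = 'X_[w].
Proof.
move=> wT; rewrite /restrict comp_mpolyX [RHS]mpolyXE_id; apply: eq_bigr => i _.
rewrite tnth_mktuple; case: (posnP (w i)) => [->|/wT ->//].
by rewrite !expr0.
Qed.

Lemma restrict_out (T : {set 'I_n}) (w : 'X_{1..m}) i :
  (0 < w i)%N -> ~~ (e i \subset T) -> restrict T 'X_[w] = 0.
Proof.
move=> wi iT; rewrite /restrict comp_mpolyX (bigD1 i) //= tnth_mktuple (negbTE iT).
by rewrite expr0n -leqn0 leqNgt wi mul0r.
Qed.

Lemma restrict_neq0 (T : {set 'I_n}) f : restrict T f != 0 ->
  exists2 w, w \in msupp f & forall y, y \notin T -> gdeg e w y = 0%N.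
Proof.
move=> fT; pose inT (w : 'X_{1..m}) := [forall i, (0 < w i)%N ==> (e i \subset T)].
have : has inT (msupp f).
  apply: contraNT fT => /hasPn no; rewrite /restrict comp_mpolyEX big_seq big1 //.
  move=> w /no; rewrite negb_forall => /existsP[i]; rewrite negb_imply => /andP[wi iT].
  by rewrite -/(restrict T _) (restrict_out wi iT) scaler0.
case/hasP=> w wf /'forall_implyP wT; exists w => // y yT.
apply/eqP; rewrite -leqn0 leqNgt; apply/gdeg_gt0P => -[i yi /wT/subsetP iT].
by rewrite iT in yT.
Qed.

(** Makes the lower bound for bar a case of the one for ara. *)
Lemma binomial_homogeneous p : I p -> is_binomial p -> G_homogeneous e p.
Proof.
move=> + [u [v pE]]; rewrite pE => /toric_ideal_binomial duv w w'.
have E x : x \in msupp ('X_[K, u] - 'X_[v]) -> gdeg e x = gdeg e v.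
  by move/msuppB_le; rewrite !msuppX mem_cat !inE => /orP[] /eqP ->.
by move=> /E -> /E ->.
Qed.

(* [f |-> f@_u] kills the product of [I] with the irrelevant ideal as soon as no
   proper divisor of ['X_[u]] is congruent to another monomial. *)
Lemma mcoeff_toric_mul a f u : I f ->
  (forall k, k != 0%MM -> (k <= u)%MM ->
     forall w, gdeg e w = gdeg e (u - k) -> w = (u - k)%MM) ->
  (a * f)@_u = a@_0 * f@_u.
Proof.
move=> If ufib; rewrite (mpolyE a) mulr_suml !raddf_sum /= mulr_suml.
apply: eq_bigr => k _; rewrite -scalerAl !mcoeffZ mcoeffX -mulrA; congr (_ * _).
rewrite mulrC; have [k0|k0] := eqVneq k 0%MM.
  by rewrite k0 mpolyX0 mulr1 mul1r.
rewrite mul0r; have [ku|ku] := boolP (k <= u)%MM.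
  rewrite -(submK ku) addmC mcoeffMX; apply/eqP; rewrite mcoeff_eq0; apply/negP.
  by case/(toric_other If) => w [_ + /(ufib _ k0 ku) wu]; rewrite wu eqxx.
apply/eqP; rewrite mcoeff_eq0 (perm_mem (msuppMX _ _)); apply: contra ku.
by case/mapP => w _ ->; apply: lem_addr.
Qed.

End Toric.

(** * Cycle binomials as minimal generators, and the lower bounds *)

Section Minimal.
Variables (K : closedFieldType) (n m : nat) (e : 'I_m -> {set 'I_n}) (A : {set 'I_n}).
Hypothesis edge_inj : injective e.
Hypothesis edge_card : forall i, #|e i| = 2%N.
Hypothesis bip : forall i x, x \in e i -> (mate e i x \in A) = (x \notin A).
Local Notation I := (toric_ideal K e).

Section OneCycle.
Variables (g : {ffun 'I_n -> 'I_m}) (S : {set 'I_n}).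
Hypothesis cg : chordless e g S.

Definition cycle_binomial : {mpoly K[m]} :=
  'X_[half_cycle g S A] - 'X_[half_cycle g S (~: A)].

Lemma cycle_binomial_toric : I cycle_binomial.
Proof.
have [du dv] := gdeg_half2 edge_card bip (chordless_circuit cg).
by apply/toric_ideal_binomial; rewrite du dv.
Qed.

Lemma cycle_half_subset B i : (0 < half_cycle g S B i)%N -> e i \subset S.
Proof.
have circ := chordless_circuit cg.
case/half_supp=> x /setIP[xS _] ->; rewrite (circuit_edge edge_card circ xS).
by rewrite subUset !sub1set xS circuit_step.
Qed.

(** By homogeneity the leading monomial has the degree of every monomial of [F i]; thus [F i]
    determines [S]. *)
Lemma cycle_survives s (F : 'I_s -> {mpoly K[m]}) :
  (forall i, I (F i) /\ G_homogeneous e (F i)) -> eq_ideal I (radical (gen_ideal F)) ->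
  exists i, [set y | gdeg e (mlead (F i)) y != 0%N] = S.
Proof.
move=> FI IE; have [k _ [c ck]] := (IE _).1 cycle_binomial_toric.
(* Otherwise a power of the cycle binomial would restrict to zero, while this binomial is nonzero
   and restricts to itself. *)
have [i Fi] : exists i, restrict e S (F i) != 0.
  apply/existsP; apply: contraT; rewrite negb_exists => /forallP F0.
  have : restrict e S (cycle_binomial ^+ k) = 0.
    rewrite ck /restrict raddf_sum big1 // => i _ /=; rewrite rmorphM /= -!/(restrict _ _ _).
    by have /eqP -> := negbNE (F0 i); rewrite mulr0.
  rewrite /restrict rmorphXn raddfB /= -!/(restrict _ _ _).
  rewrite !restrict_in; try exact: cycle_half_subset.
  move/eqP; rewrite expf_eq0 => /andP[_ /eqP/(congr1 (mcoeff (half_cycle g S A)))].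
  rewrite mcoeffB !mcoeffX eqxx eq_sym (negbTE (half_neq edge_card bip cg)) subr0 mcoeff0.
  by move/eqP; rewrite oner_eq0.
have [IFi hFi] := FI i; exists i.
have [w wF wS] := restrict_neq0 Fi.
have [w' [_ w'w dw]] := toric_other IFi wF.
have Fi0 : F i != 0 by apply: contraTneq wF => ->; rewrite msupp0.
apply/setP => y; rewrite inE (hFi _ _ (mlead_supp Fi0) wF).
by apply: (chordless_full edge_card cg wS (esym dw)); apply/eqP; rewrite eq_sym.
Qed.

Lemma mcoeff_cycle_mul a f : I f ->
  (a * f)@_(half_cycle g S A) = a@_0 * f@_(half_cycle g S A).
Proof.
have [du dv] := gdeg_half2 edge_card bip (chordless_circuit cg).
move=> If; apply: mcoeff_toric_mul If _ => k k0 ku w dw.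
have : gdeg e (w + k) = mnm_set S by rewrite gdegD dw -gdegD submK.
(* If [w + k] were the second half, the nonzero [k] would divide both disjoint halves. *)
case/(chordless_fiber edge_card bip cg) => wk.
  by rewrite -wk addmK.
have [j kj] := mnm_neq0P _ k0.
have := half_disjoint edge_card cg (leq_trans kj (mnm_lepP ku j)).
by rewrite -wk mnmDE => /eqP; rewrite addn_eq0 andbC -leqn0 leqNgt kj.
Qed.

End OneCycle.

Variables (N : nat) (T : 'I_N -> {set 'I_n}) (g : 'I_N -> {ffun 'I_n -> 'I_m}).
Hypothesis T_inj : injective T.
Hypothesis T_chordless : forall i, chordless e (g i) (T i).
Hypothesis T_all : forall h S, chordless e h S -> exists i, S = T i.
Let B i := cycle_binomial (g i) (T i).

Lemma toric_ideal_cycles : eq_ideal I (gen_ideal B).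
Proof.
move=> f; split=> [|[c ->]]; last first.
  by apply: toric_ideal_sum => i; apply: cycle_binomial_toric.
apply: toric_generated; [exact: gen_ideal0 | exact: gen_idealD | exact: gen_idealM |].
apply: (fiber_ind edge_inj edge_card bip).
- by move=> u; rewrite subrr; apply: gen_ideal0.
- move=> u v w uv vw.
  by rewrite -['X_[u]](subrK 'X_[v]) -addrA; apply: gen_idealD.
- by move=> w u v uv; rewrite !mpolyXD -mulrBr; apply: gen_idealM.
move=> h S ch; have [i Si] := T_all ch; subst S.
have [du dv] := gdeg_half2 edge_card bip (chordless_circuit (T_chordless i)).
have uv := half_neq edge_card bip (T_chordless i).
have Bi := gen_ideal_mem B i; move: Bi; rewrite /B /cycle_binomial.
(* [h] and [g i] may orient the cycle oppositely, which changes the sign of the binomial. *)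
have [eu|eu] := chordless_fiber edge_card bip ch du;
  have [ev|ev] := chordless_fiber edge_card bip ch dv; rewrite eu ev //;
  try by rewrite eu ev eqxx in uv.
by move/gen_idealN; rewrite opprB.
Qed.

(** The toric ideal is radical, being the kernel of a map into a domain. *)
Lemma toric_radical s (F : 'I_s -> {mpoly K[m]}) :
  eq_ideal I (gen_ideal F) -> eq_ideal I (radical (gen_ideal F)).
Proof.
move=> IE p; split=> [/IE Fp|[k _ /IE]]; first by exists 1%N.
exact: toric_ideal_pow.
Qed.

Lemma cycles_le_mu s (F : 'I_s -> {mpoly K[m]}) :
  eq_ideal I (gen_ideal F) -> (N <= s)%N.
Proof.
move=> IE; pose u i := half_cycle (g i) (T i) A.
have FI i : I (F i) by apply/IE; apply: gen_ideal_mem.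
have BF j : exists c : 'I_s -> {mpoly K[m]}, B j = \sum_i c i * F i.
  by apply/IE; apply: cycle_binomial_toric.
have [c cE] := fin_all_exists BF.
(* By [mcoeff_cycle_mul] these matrices factor the identity of size [N] through dimension [s], and
   the rank gives the bound. *)
pose C := \matrix_(j < N, i < s) (c j i)@_0.
pose D := \matrix_(i < s, l < N) (F i)@_(u l).
have CD : C *m D = 1%:M.
  apply/matrixP => j l; rewrite !mxE.
  transitivity ((B j)@_(u l)).
    rewrite cE raddf_sum /=; apply: eq_bigr => i _.
    by rewrite !mxE mcoeff_cycle_mul.
  rewrite /B /cycle_binomial mcoeffB !mcoeffX.
  have [->|jl] := eqVneq j l.
    by rewrite eqxx eq_sym (negbTE (half_neq edge_card bip (T_chordless l))) subr0.
  have [du dv] := gdeg_half2 edge_card bip (chordless_circuit (T_chordless j)).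
  have [du' _] := gdeg_half2 edge_card bip (chordless_circuit (T_chordless l)).
  have nT w : gdeg e w = mnm_set (T j) -> (w == u l) = false.
    move=> dw; apply: contraNF jl => /eqP wu; apply/eqP/T_inj/setP => x.
    move: dw; rewrite wu du' => /mnmP/(_ x); rewrite !mnmE.
    by do 2 case: (x \in _).
  by rewrite !nT // subr0.
have := mulmx_max_rank C D.
by rewrite CD mxrank1.
Qed.

Lemma cycles_le_ara s (F : 'I_s -> {mpoly K[m]}) :
  (forall i, I (F i) /\ G_homogeneous e (F i)) -> eq_ideal I (radical (gen_ideal F)) ->
  (N <= s)%N.
Proof.
move=> FI IE; have T_survives j := cycle_survives (T_chordless j) FI IE.
have [k kE] := fin_all_exists T_survives.
have k_inj : injective k by move=> i j kij; apply: T_inj; rewrite -!kE kij.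
by have := leq_card k k_inj; rewrite !card_ord.
Qed.

Lemma cycle_ranks : [/\ is_mu I N, is_bar I N & is_ara_G e I N].
Proof.
have BI i : I (B i) /\ is_binomial (B i).
  split; first exact: cycle_binomial_toric.
  by exists (half_cycle (g i) (T i) A), (half_cycle (g i) (T i) (~: A)).
have bin_homog p : I p /\ is_binomial p -> I p /\ G_homogeneous e p.
  by case=> Ip bp; split=> //; apply: binomial_homogeneous.
have IB := toric_ideal_cycles; have IrB := toric_radical IB.
split; split.
- by exists B.
- by move=> s [F]; apply: cycles_le_mu.
- by exists B.
- by move=> s [F [FI]]; apply: cycles_le_ara => i; apply: bin_homog.
- by exists B; split=> // i; apply: bin_homog.
- by move=> s [F [FI]]; apply: cycles_le_ara.
Qed.

End Minimal.

Theorem theorem3p2 (K : closedFieldType) (n m : nat) (e : 'I_m -> {set 'I_n}) :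
  simple_graph e -> connected_graph e -> bipartite_graph e ->
  exists mu : nat,
    [/\ is_mu (toric_ideal K e) mu,
        is_bar (toric_ideal K e) mu
      & is_ara_G e (toric_ideal K e) mu].
Proof.
move=> [edge_inj edge_card] _ [A adjA].
have bip i x : x \in e i -> (mate e i x \in A) = (x \notin A).
  move=> /(mateP edge_card)[eix _].
  have /adjA : adj e x (mate e i x) by apply/existsP; exists i; rewrite {1}eix.
  by do 2 case: (_ \in A).
(* Cycles are counted by vertex sets, since [g] also records an orientation and arbitrary values
   outside [S]. *)
pose cycles := [set S | [exists g, chordless e g S]].
have cycleP (i : 'I_#|cycles|) : exists g, chordless e g (enum_val i).
  by have := enum_valP i; rewrite inE => /existsP.
have [g gP] := fin_all_exists cycleP.
exists #|cycles|; apply: (cycle_ranks K edge_inj edge_card bip enum_val_inj gP).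
move=> h S hS; have Sc : S \in cycles by rewrite inE; apply/existsP; exists h.
by exists (enum_rank_in Sc S); rewrite enum_rankK_in.
Qed.
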